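(* Let $M$ be a near sup-magma and $n$ a positive integer. (1) $\mathsf{N}^n(M)$ is a near multiplicative lattice under the operation $\vee$ of binary supremum, with $\mathsf{N}^n(M)=\mathsf{R}(\mathsf{N}^n(M))$ and $\mathsf{N}(\mathsf{N}^n(M))=\mathsf{C}(\mathsf{N}^n(M))$. (2) The pair of maps $d_-:\mathsf{N}^n(M)\to\mathsf{N}^{n+1}(M)$ and $d^-:\mathsf{N}^{n+1}(M)\to\mathsf{N}^n(M)$ is a faithful order-preserving Galois connection. (3) The map $d_-:\mathsf{N}^n(M)\to\mathsf{N}^{n+1}(M)$ is an embedding of near multiplicative lattices.
   Context: An ordered magma is a magma (not assumed associative, commutative or unital) with a partial order such that $x\le x'$ and $y\le y'$ imply $xy\le x'y'$. A near sup-magma is an ordered magma in which every nonempty subset has a supremum. A near multiplicative lattice is a near sup-magma that is a commutative monoid and satisfies $a\bigvee X=\bigvee(aX)$ for all elements $a$ and nonempty subsets $X$. A closure operation on a poset is an expansive, order-preserving, idempotent self-map; a nucleus on an ordered magma is a closure operation $\star$ with $x^\star y^\star\le(xy)^\star$ for all $x,y$ (where $x^\star=\star(x)$). $\mathsf{C}(S)$ denotes the poset of closure operations on a poset $S$ and $\mathsf{N}(M)$ the poset of nuclei on an ordered magma $M$, ordered pointwise. For a near sup-magma $M$, $\mathsf{N}(M)$ is a complete lattice, and any complete lattice $L$ is regarded as an ordered commutative monoid under $\vee$ (with identity its least element), for which $\mathsf{N}(L)$ is again complete. Set $\mathsf{N}^1(M)=\mathsf{N}(M)$ and $\mathsf{N}^{n+1}(M)=\mathsf{N}(\mathsf{N}^n(M))$,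 where $\mathsf{N}^n(M)$ has multiplication $\vee$. For a unital ordered magma $L$, $\mathsf{R}(L)=\{x\in L: x^2=x,\ x\ge1\}$. The map $d_-$ sends $a\in\mathsf{N}^n(M)$ to the nucleus $d_a:x\mapsto a\vee x$ on $\mathsf{N}^n(M)$, and $d^-$ sends a nucleus $\star$ on $\mathsf{N}^n(M)$ to $1^\star$, where $1$ is the identity (least) element of $\mathsf{N}^n(M)$. An order-preserving Galois connection from $S$ to $T$ is a pair of order-preserving maps $f:S\to T$, $g:T\to S$ with $f(a)\le b\iff a\le g(b)$ for all $a\in S$, $b\in T$; it is faithful if $f$ is injective (equivalently $g\circ f=\mathrm{id}_S$). An embedding of near multiplicative lattices is a magma homomorphism that preserves suprema of nonempty subsets and is a poset embedding. *)

(* Defs.v *)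
From HB Require Import structures.
From mathcomp Require Import all_boot all_order.
From mathcomp Require Import boolp classical_sets.

Set Implicit Arguments.
Unset Strict Implicit.
Unset Printing Implicit Defensive.

Import Order.TTheory.
Local Open Scope classical_set_scope.
Local Open Scope group_scope.
Local Open Scope order_scope.

HB.mixin Record isOrderedMagma (d : Order.disp_t) T
    of Magma T & Order.POrder d T := {
  le_mulg : forall x x' y y' : T, x <= x' -> y <= y' -> (x * y <= x' * y')%g
}.

#[short(type="orderedMagmaType")]
HB.structure Definition OrderedMagma (d : Order.disp_t) :=
  {T of isOrderedMagma d T & Magma T & Order.POrder d T}.

#[short(type="orderedUMagmaType")]
HB.structure Definition OrderedUMagma (d : Order.disp_t) :=
  {T of OrderedMagma d T & UMagma T}.

Definition has_nonempty_sups d (T : porderType d) : Prop :=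
  forall X : set T, X !=set0 -> exists s : T, isLub X s.

HB.mixin Record isNearSupMagma (d : Order.disp_t) T of OrderedMagma d T := {
  ex_lub : has_nonempty_sups T
}.

#[short(type="nearSupMagmaType")]
HB.structure Definition NearSupMagma (d : Order.disp_t) :=
  {T of isNearSupMagma d T & OrderedMagma d T}.

(* A complete lattice regarded as an ordered magma under binary joins, with
   identity its least element.  Suprema of nonempty sets come from
   [NearSupMagma], the supremum of the empty set is [\bot]. *)
HB.mixin Record isJoinMagma (d : Order.disp_t) T
    of NearSupMagma d T & Order.BJoinSemilattice d T & UMagma T := {
  mulg_join : forall x y : T, (x * y)%g = x `|` y;
  oneg_bot : (1%g : T) = \bot
}.

#[short(type="completeJoinType")]
HB.structure Definition CompleteJoin (d : Order.disp_t) :=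
  {T of isJoinMagma d T & NearSupMagma d T & Order.BJoinSemilattice d T
      & UMagma T}.

Definition near_multiplicative_lattice d (L : orderedMagmaType d) : Prop :=
  [/\ has_nonempty_sups L,
      associative (fun x y : L => (x * y)%g),
      commutative (fun x y : L => (x * y)%g),
      (exists e : L, left_id e (fun x y : L => (x * y)%g) /\
                     right_id e (fun x y : L => (x * y)%g)) &
      forall (a : L) (X : set L) (s : L), X !=set0 -> isLub X s ->
        isLub [set (a * x)%g | x in X] (a * s)%g].

Definition closure_operation d (S : porderType d) (f : S -> S) : Prop :=
  [/\ forall x, x <= f x,
      {homo f : x y / x <= y} &
      forall x, f (f x) = f x].

(* [closures S] and [nuclei M] are the underlying sets of C(S) and N(M), both
   ordered as subsets of the pointwise ordered function spaces. *)
Definition closures d (S : porderType d) : set (S -> S) :=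
  [set f | closure_operation f].
Arguments closures {d} S.

Definition nuclei d (M : orderedMagmaType d) : set (M -> M) :=
  [set f | closure_operation f /\ forall x y, (f x * f y)%g <= f (x * y)%g].
Arguments nuclei {d} M.

Record nucleus d (M : orderedMagmaType d) : Type := Nucleus {
  nucleus_fun :> M -> M;
  nucleus_mem : nucleus_fun \in nuclei M
}.

Definition idempotents_ge1 d (L : orderedUMagmaType d) : set L :=
  [set x | (x * x)%g = x /\ (1%g : L) <= x].
Arguments idempotents_ge1 {d} L.

Section NucleusOrder.
Variables (d : Order.disp_t) (M : orderedMagmaType d).

HB.instance Definition _ := [isSub for @nucleus_fun d M].
HB.instance Definition _ := [Choice of nucleus M by <:].
HB.instance Definition _ := [SubChoice_isSubPOrder of nucleus M by <: with d].

Lemma le_nucleusP (f g : nucleus M) :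
  reflect (forall x, f x <= g x) (f <= g).
Proof. exact: lefP. Qed.

End NucleusOrder.

Section NucleusLattice.
Variables (d : Order.disp_t) (M : nearSupMagmaType d).
Implicit Types f g h : nucleus M.

Definition nucleus_of (f : M -> M) (fN : nuclei M f) : nucleus M :=
  Nucleus (mem_set fN).

Lemma nucleusP f : nuclei M f.
Proof. exact: set_mem (nucleus_mem f). Qed.

Lemma ex_nucleus_glb (B : set (nucleus M)) :
  exists f, lbound B f /\ forall g, lbound B g -> g <= f.
Proof.
pose low x : set M := [set y | forall g, B g -> y <= g x].
have low_id x : low x x by move=> g _; have [[+ _ _] _] := nucleusP g; exact.
have infP x : {m | isLub (low x) m} by apply: cid; apply: ex_lub; exists x.
pose f x := sval (infP x).
have lowf x : low x (f x).
  by move=> g Bg; apply: (svalP (infP x)).2 => y; apply.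
have lef x y : low x y -> y <= f x by exact: (svalP (infP x)).1.
have fN : nuclei M f.
  split; first split.
  - by move=> x; apply: lef.
  - move=> x y xy; apply: lef => g Bg.
    have [[_ gm _] _] := nucleusP g.
    exact: le_trans (lowf _ _ Bg) (gm _ _ xy).
  - move=> x; apply/le_anti/andP; split; last exact: lef.
    apply: lef => g Bg; have [[_ gm gi] _] := nucleusP g.
    by rewrite -gi; apply: le_trans (lowf _ _ Bg) _; apply/gm/lowf.
  - move=> x y; apply: lef => g Bg; have [_ gn] := nucleusP g.
    by apply: le_trans (gn x y); apply: le_mulg; apply: lowf.
exists (nucleus_of fN); split.
  by move=> g Bg; apply/le_nucleusP => x; apply: lowf.
move=> g gB; apply/le_nucleusP => x; apply: lef => h Bh.
by move/le_nucleusP : (gB _ Bh); exact.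
Qed.

Lemma ex_nucleus_lub (A : set (nucleus M)) : exists f, isLub A f.
Proof.
have [f [fl fg]] := ex_nucleus_glb (ubound A).
by exists f; split => [g Ag|]; [apply: fg => h; apply | exact: fl].
Qed.

Definition nucleus_join f g : nucleus M :=
  sval (cid (ex_nucleus_lub [set f; g])).

Lemma nucleus_leUx f g h : (nucleus_join f g <= h) = (f <= h) && (g <= h).
Proof.
rewrite /nucleus_join; case: cid => k /= [ku kl].
apply/idP/andP => [kh|[fh gh]].
  by split; apply: le_trans kh; apply: ku; [left|right].
by apply: kl => l [->|->].
Qed.

Lemma id_nucleus : nuclei M id.
Proof. by split=> //; split. Qed.

Lemma nucleus_le0x f : nucleus_of id_nucleus <= f.
Proof. by apply/le_nucleusP => x; have [[+ _ _] _] := nucleusP f; exact. Qed.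

HB.instance Definition _ :=
  Order.POrder_isJoinSemilattice.Build d (nucleus M) nucleus_leUx.
HB.instance Definition _ :=
  Order.hasBottom.Build d (nucleus M) nucleus_le0x.

HB.instance Definition _ := hasMul.Build (nucleus M) Order.join.
HB.instance Definition _ :=
  Magma_isUMagma.Build (nucleus M) (@join0x _ _) (@joinx0 _ _).

Lemma nucleus_le_mul (x x' y y' : nucleus M) :
  x <= x' -> y <= y' -> (x * y)%g <= (x' * y')%g.
Proof. exact: leU2. Qed.

HB.instance Definition _ := isOrderedMagma.Build d (nucleus M) nucleus_le_mul.

Lemma nucleus_ex_lub : has_nonempty_sups (nucleus M).
Proof. by move=> A _; apply: ex_nucleus_lub. Qed.

HB.instance Definition _ := isNearSupMagma.Build d (nucleus M) nucleus_ex_lub.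
HB.instance Definition _ :=
  isJoinMagma.Build d (nucleus M) (fun _ _ => erefl) erefl.

End NucleusLattice.

(* [nuclei_pow M n] is N^n(M) for n > 0; the value at 0 is irrelevant. *)
Definition nuclei_pow d (M : nearSupMagmaType d) (n : nat) :
    completeJoinType d :=
  iter n.-1 (fun L : completeJoinType d => nucleus L : completeJoinType d)
       (nucleus M).

Lemma nuclei_pow1 d (M : nearSupMagmaType d) :
  nuclei_pow M 1 = nucleus M :> completeJoinType d.
Proof. by []. Qed.

Lemma nuclei_powS d (M : nearSupMagmaType d) (n : nat) : (0 < n)%N ->
  nuclei_pow M n.+1 = nucleus (nuclei_pow M n) :> completeJoinType d.
Proof. by case: n. Qed.

(* [d_lower] is d_-, sending a to the nucleus d_a; [d_upper] is d^-. *)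
Section DMaps.
Variables (d : Order.disp_t) (L : completeJoinType d).

Lemma join_nucleus (a : L) : nuclei L (fun x => a `|` x).
Proof.
split; first split.
- by move=> x; rewrite leUr.
- by move=> x y xy; rewrite leU2.
- by move=> x; rewrite joinA joinxx.
- by move=> x y; rewrite !mulg_join joinACA joinxx.
Qed.

Definition d_lower (a : L) : nucleus L := nucleus_of (join_nucleus a).

Definition d_upper (f : nucleus L) : L := f 1%g.

Lemma d_lowerE (a x : L) : d_lower a x = a `|` x.
Proof. by []. Qed.

End DMaps.

Section Connections.
Variables (d d' : Order.disp_t).

Definition galois_connection (S : porderType d) (T : porderType d')
    (f : S -> T) (g : T -> S) : Prop :=
  [/\ {homo f : x y / x <= y},
      {homo g : x y / x <= y} &
      forall a b, (f a <= b) <-> (a <= g b)].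

Definition faithful_galois_connection (S : porderType d) (T : porderType d')
    (f : S -> T) (g : T -> S) : Prop :=
  galois_connection f g /\ injective f.

Definition near_multiplicative_lattice_embedding
    (L : orderedMagmaType d) (L' : orderedMagmaType d') (f : L -> L') : Prop :=
  [/\ near_multiplicative_lattice L,
      near_multiplicative_lattice L',
      {morph f : x y / (x * y)%g},
      forall (X : set L) (s : L), X !=set0 -> isLub X s ->
        isLub [set f x | x in X] (f s) &
      {mono f : x y / x <= y}].

End Connections.

(* Main.v *)
(* Only the complete join structure of L = N^n(M) matters: multiplication is
   binary join, so every element is an idempotent above 1 and every closure
   operation is a nucleus; and d_a <= f iff a <= f 1, because f is monotone,
   expansive and idempotent. *)
Require Import Defs.
From HB Require Import structures.
From mathcomp Require Import all_boot all_order.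
From mathcomp Require Import boolp classical_sets.

Set Implicit Arguments.
Unset Strict Implicit.
Unset Printing Implicit Defensive.

Import Order.TTheory.

Section CompleteJoin.
Local Open Scope classical_set_scope.
Local Open Scope order_scope.
Variables (d : Order.disp_t) (L : completeJoinType d).
Implicit Types (a x y s : L) (X : set L) (f : nucleus L).

Lemma isLub_mulg x y : isLub [set x; y] (x * y)%g.
Proof.
rewrite mulg_join; split=> [z [->|->]|z zub]; rewrite ?leUl ?leUr// leUx.
by rewrite !zub//; [right|left].
Qed.

Lemma isLub_mulgl a X s : X !=set0 -> isLub X s ->
  isLub [set (a * x)%g | x in X] (a * s)%g.
Proof.
move=> [x0 Xx0] [sub slub]; split=> [_ [x Xx <-]|z zub].
  by rewrite !mulg_join leU2// sub.
have le_ax x : X x -> a `|` x <= z.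
  by move=> Xx; rewrite -mulg_join; apply: zub; exists x.
(* Nonemptiness enters here: the member [x0] of [X] is what forces [a <= z]. *)
rewrite mulg_join leUx (le_trans _ (le_ax _ Xx0)) ?leUl//=.
by apply: slub => x Xx; rewrite (le_trans _ (le_ax _ Xx)) ?leUr.
Qed.

Lemma completeJoin_near_multiplicative_lattice : near_multiplicative_lattice L.
Proof.
split; [exact: ex_lub| | | |exact: isLub_mulgl].
- by move=> x y z; rewrite !mulg_join joinA.
- by move=> x y; rewrite !mulg_join joinC.
- by exists 1%g; split=> x; rewrite mulg_join oneg_bot ?join0x ?joinx0.
Qed.

Lemma idempotents_ge1_completeJoin : [set: L] = idempotents_ge1 L.
Proof.
by apply/seteqP; split=> // x _; split; rewrite ?mulg_join ?joinxx// oneg_bot le0x.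
Qed.

(** By monotonicity [f x] and [f y] both lie below [f (x * y)], hence so does their join, which is
    their product. *)
Lemma nuclei_completeJoin : nuclei L = closures L.
Proof.
apply/seteqP; split=> [f []//|f fC]; split=> // x y.
by have [_ fm _] := fC; rewrite !mulg_join leUx !fm ?leUl ?leUr.
Qed.

(** The adjunction behind all later facts on [d_lower]; as a boolean equality it can be used for
    rewriting. *)
Lemma d_lower_le a f : (d_lower a <= f) = (a <= d_upper f).
Proof.
have [[fe fm fi] _] := nucleusP f.
apply/idP/idP=> [/le_nucleusP/(_ 1%g)|af]; first by rewrite d_lowerE leUx => /andP[].
apply/le_nucleusP => x; rewrite d_lowerE leUx fe andbT.
(* The chain is [a <= f 1 <= f x], since [1] is least. *)
by apply: le_trans af _; apply: fm; rewrite oneg_bot le0x.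
Qed.

Lemma d_lowerK : cancel (@d_lower d L) (@d_upper d L).
Proof. by move=> a; rewrite /d_upper d_lowerE oneg_bot joinx0. Qed.

Lemma d_lower_mono : {mono @d_lower d L : x y / x <= y}.
Proof. by move=> x y; rewrite d_lower_le d_lowerK. Qed.

(** A left adjoint preserves suprema: upper bounds are transposed to [L] and back. *)
Lemma d_lower_lub X s : isLub X s -> isLub [set d_lower x | x in X] (d_lower s).
Proof.
move=> [sub slub]; split=> [_ [x Xx <-]|f fub].
  by rewrite d_lower_mono sub.
rewrite d_lower_le; apply: slub => x Xx.
by rewrite -d_lower_le; apply: fub; exists x.
Qed.

Lemma d_lowerM : {morph @d_lower d L : x y / (x * y)%g}.
Proof.
move=> x y; rewrite !mulg_join; apply/le_anti/andP; split.
  (* Transposing splits the join on the left inside [L]; transposing back leaves each factor below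
     the join of nuclei. *)
  by rewrite d_lower_le leUx -!d_lower_le leUl leUr.
by rewrite leUx !d_lower_mono leUl leUr.
Qed.

Lemma d_lower_galois :
  faithful_galois_connection (@d_lower d L) (@d_upper d L).
Proof.
split; last exact: can_inj d_lowerK.
split=> [x y|f g /le_nucleusP|a f]; first by rewrite d_lower_mono.
- exact.
- by rewrite d_lower_le.
Qed.

End CompleteJoin.

Lemma d_lower_embedding (d : Order.disp_t) (L : completeJoinType d) :
  near_multiplicative_lattice_embedding (@d_lower d L).
Proof.
split; [exact: completeJoin_near_multiplicative_lattice| |exact: d_lowerM
       | |exact: d_lower_mono].
- exact: (@completeJoin_near_multiplicative_lattice d (nucleus L)).
- by move=> X s _; apply: d_lower_lub.
Qed.

Theorem corollary9p6 (d : Order.disp_t) (M : nearSupMagmaType d) (n : nat) :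
  (0 < n)%N ->
  let L := nuclei_pow M n in
  [/\ [/\ near_multiplicative_lattice L,
          forall x y : L, isLub [set x; y]%classic (x * y)%g,
          [set: L]%classic = idempotents_ge1 L &
          nuclei L = closures L],
      faithful_galois_connection (@d_lower d L) (@d_upper d L) &
      near_multiplicative_lattice_embedding (@d_lower d L)].
Proof.
(* No induction on [n]: each iterate is a [completeJoinType], so the results for arbitrary [L]
   apply. *)
move=> _ L; split; last exact: d_lower_embedding; last exact: d_lower_galois.
split; [exact: completeJoin_near_multiplicative_lattice|exact: isLub_mulg
       |exact: idempotents_ge1_completeJoin|exact: nuclei_completeJoin].
Qed.
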